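(* Let $k$ be a field, let $\tilde G=SL_3$, and let $G=\tilde G\rtimes\langle\sigma\rangle$, where $\sigma$ is the non-trivial graph automorphism of $\tilde G$. Then there exists a $k$-subgroup $H$ of $G$ such that $H$ is not $G$-completely reducible over $k$ and $\Lambda(G)^H$ is not a subset of $\Delta(G)$. Moreover, the set $\Lambda(G)$, ordered by reversed inclusion, does not form a simplicial complex.
   Context: Algebraic groups are affine, possibly non-connected, taken in the sense of Borel: (reduced) algebraic groups over an algebraic closure $\overline{k}$ of $k$, identified with their $\overline{k}$-points, with $k$-structures. ''Subgroup'' means closed subgroup; a $k$-subgroup is a closed subgroup defined over $k$. The group $SL_3$ carries its standard split $k$-structure. With respect to a $k$-split maximal torus $T$, a Borel $k$-subgroup $B\supset T$ and the simple roots $\alpha,\beta$, $\sigma$ is the order-2 $k$-automorphism stabilizing $T$ and $B$ and interchanging $\alpha$ and $\beta$ (namely $A\mapsto n(A^{T})^{-1}n^{-1}$ with $n$ a representative of the longest Weyl group element). For a (possibly non-connected) reductive group $G$ and a cocharacter $\lambda:\overline{k}^*\to G$, let $P_\lambda=\{g\in G\mid \lim_{a\to 0}\lambda(a)g\lambda(a)^{-1}\text{ exists}\}$ and $L_\lambda=\{g\in G\mid \lim_{a\to 0}\lambda(a)g\lambda(a)^{-1}=g\}=C_G(\lambda(\overline{k}^* ))$. Here $\lim_{a\to 0}\phi(a)$ exists if the morphism $\phi:\overline{k}^*\to G$ extends to a morphism $\hat\phi:\overline{k}\to G$, and then the limit is $\hat\phi(0)$. The subgroups $P_\lambda$ are the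 $R$-parabolic subgroups of $G$, and $L_\lambda$ is an $R$-Levi subgroup of $P_\lambda$. A closed subgroup $H$ of $G$ is $G$-completely reducible over $k$ if, whenever $H$ is contained in a $k$-defined $R$-parabolic subgroup $P$ of $G$, it is contained in some $k$-defined $R$-Levi subgroup of $P$. $\Lambda(G)$ is the set of $k$-defined $R$-parabolic subgroups of $G$, and $\Lambda(G)^H$ is the set of those containing $H$. $\Delta(G)=\Delta(G^\circ)$ is the spherical building of $G^\circ$ over $k$; its simplices are identified with the proper parabolic $k$-subgroups of $G^\circ$ (ordered by reversed inclusion). ''Simplicial complex'' is meant in the sense of Tits: a partially ordered set in which, for each element $A$, the set of elements $\le A$ (faces of $A$) is isomorphic, as an ordered set, to the set of all subsets of some set ordered by inclusion, and in which any two elements have a greatest lower bound. *)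

(* Defs.v *)
From HB Require Import structures.
From mathcomp Require Import all_boot all_order all_algebra.
From mathcomp Require Import boolp classical_sets.
From mathcomp Require Import mpoly.

Set Implicit Arguments.
Unset Strict Implicit.
Unset Printing Implicit Defensive.

Import GRing.Theory.
Local Open Scope classical_set_scope.
Local Open Scope ring_scope.

Section AbstractGroups.
Variable G : groupType.
Implicit Types A H : set G.
Local Open Scope group_scope.

Definition subgroup H : Prop :=
  [/\ H 1, forall g h, H g -> H h -> H (g * h) & forall g, H g -> H g^-1].

Definition gen A : set G :=
  [set g | forall H, subgroup H -> A `<=` H -> H g].

Definition derived_subgroup H : set G :=
  gen [set g | exists a b, [/\ H a, H b & g = [~ a, b]]].

Definition solvable_subgroup H : Prop :=
  exists m, iter m derived_subgroup H = [set 1].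

End AbstractGroups.

(* An affine algebraic group over K with a k-structure, iota : k -> K, is
   given by its abstract group G of K-points and by an embedding x of G as a
   Zariski closed subset of the affine space K^n, defined over k; K[G] is
   K[X_1, ..., X_n] modulo the polynomials vanishing on G, and k[G] is the
   image of k[X_1, ..., X_n]. *)
Section AlgebraicGroups.
Variables (k : fieldType) (K : closedFieldType) (iota : {rmorphism k -> K}).
Variables (n : nat) (G : groupType) (x : G -> 'rV[K]_n).
Implicit Types (X H P L M B : set G) (f : {mpoly K[n]}) (lambda phi : K -> G).

Definition vanishes f X : Prop := forall g, X g -> f.@[x g 0] = 0.

Definition zclosed X : Prop :=
  exists S : set {mpoly K[n]},
    X = [set g | forall f, S f -> f.@[x g 0] = 0].

(* The ideal of X is spanned over K by its elements with coefficients in k. *)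
Definition defined_over X : Prop :=
  forall f, vanishes f X ->
    exists m (c : 'I_m -> K) (q : 'I_m -> {mpoly k[n]}),
      (forall i, vanishes (map_mpoly iota (q i)) X) /\
      f = \sum_(i < m) c i *: map_mpoly iota (q i).

Definition k_subgroup H : Prop :=
  [/\ subgroup H, zclosed H & defined_over H].

Definition zconnected X : Prop :=
  forall Y Z, zclosed Y -> zclosed Z ->
    X `<=` Y `|` Z -> X `&` (Y `&` Z) = set0 -> X `<=` Y \/ X `<=` Z.

Definition identity_component : set G :=
  [set g | exists X, [/\ zconnected X, X 1%g & X g]].

(* Functions on K^* are represented by functions on K whose value at 0 is
   irrelevant; K[K^*] = K[t, t^-1]. *)
Definition morphism_of_units phi : Prop :=
  forall i, exists (p : {poly K}) (d : nat),
    forall a, a != 0 -> x (phi a) 0 i = p.[a] / a ^+ d.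

Definition morphism_of_line phi : Prop :=
  forall i, exists p : {poly K}, forall a, x (phi a) 0 i = p.[a].

Definition is_limit phi (h : G) : Prop :=
  exists psi : K -> G,
    [/\ morphism_of_line psi, forall a, a != 0 -> psi a = phi a & psi 0 = h].

Definition cocharacter lambda : Prop :=
  morphism_of_units lambda /\
  forall a b, a != 0 -> b != 0 -> lambda (a * b) = (lambda a * lambda b)%g.

Definition conj_by lambda (g : G) : K -> G :=
  fun a => (lambda a * g * (lambda a)^-1)%g.

Definition P_ lambda : set G := [set g | exists h, is_limit (conj_by lambda g) h].

Definition L_ lambda : set G := [set g | is_limit (conj_by lambda g) g].

Definition R_parabolic P : Prop :=
  exists2 lambda, cocharacter lambda & P = P_ lambda.

Definition R_Levi P L : Prop :=
  exists lambda, [/\ cocharacter lambda, P = P_ lambda & L = L_ lambda].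

Definition Lambda : set (set G) :=
  [set P | R_parabolic P /\ defined_over P].

Definition Lambda_fix H : set (set G) := [set P | Lambda P /\ H `<=` P].

Definition G_cr_over H : Prop :=
  forall P, Lambda P -> H `<=` P ->
    exists L, [/\ R_Levi P L, defined_over L & H `<=` L].

Definition Borel_candidate M B : Prop :=
  [/\ subgroup B, zclosed B, zconnected B, solvable_subgroup B & B `<=` M].

Definition Borel_subgroup M B : Prop :=
  Borel_candidate M B /\ forall C, Borel_candidate M C -> B `<=` C -> C = B.

Definition parabolic M P : Prop :=
  [/\ subgroup P, zclosed P, P `<=` M & exists2 B, Borel_subgroup M B & B `<=` P].

(* The simplices of the spherical building of the identity component over k. *)
Definition building : set (set G) :=
  [set P | [/\ parabolic identity_component P, defined_over P
             & P <> identity_component]].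

End AlgebraicGroups.

Section SimplicialComplexes.
Variables (T : Type) (le : T -> T -> Prop).

Definition partial_order : Prop :=
  [/\ forall A, le A A, forall A B, le A B -> le B A -> A = B
    & forall A B C, le A B -> le B C -> le A C].

Definition faces_form_power_set (A : T) : Prop :=
  exists (S : Type) (F : {B : T | le B A} -> set S),
    bijective F /\ forall B C, le (sval B) (sval C) <-> F B `<=` F C.

Definition is_glb (A B C : T) : Prop :=
  [/\ le C A, le C B & forall D, le D A -> le D B -> le D C].

Definition simplicial_complex : Prop :=
  [/\ partial_order, forall A, faces_form_power_set A
    & forall A B, exists C, is_glb A B C].

End SimplicialComplexes.

Definition rev_incl (T : Type) (E : set (set T)) (P Q : {P : set T | E P}) : Prop :=
  sval Q `<=` sval P.

Lemma rev_incl_partial_order (T : Type) (E : set (set T)) :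
  partial_order (@rev_incl T E).
Proof.
split=> [A|A B leAB leBA|A B C leAB leBC]; first exact: subset_refl.
- case: A B leAB leBA => [A EA] [B EB] /= leAB leBA.
  by apply: eq_exist; apply/seteqP.
- exact: subset_trans leBC leAB.
Qed.

Section SL3.
Variable F : fieldType.

Record SL3 := MkSL3 { slmx :> 'M[F]_3; _ : \det slmx == 1 }.

HB.instance Definition _ := [isSub for slmx].
HB.instance Definition _ := [Choice of SL3 by <:].

Implicit Types A B C : SL3.

Lemma det_SL3 A : \det A = 1.
Proof. by case: A => A /= /eqP. Qed.

Lemma SL3_unit A : (A : 'M[F]_3) \in unitmx.
Proof. by rewrite unitmxE det_SL3 unitr1. Qed.

Fact sl_one_subproof : \det (1%:M : 'M[F]_3) == 1.
Proof. by rewrite det1. Qed.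
Definition sl_one := MkSL3 sl_one_subproof.

Fact sl_mul_subproof A B : \det (A *m B) == 1.
Proof. by rewrite det_mulmx !det_SL3 mulr1. Qed.
Definition sl_mul A B := MkSL3 (sl_mul_subproof A B).

Fact sl_inv_subproof A : \det (invmx A) == 1.
Proof. by rewrite det_inv det_SL3 invr1. Qed.
Definition sl_inv A := MkSL3 (sl_inv_subproof A).

Fact sl_mulA : associative sl_mul.
Proof. by move=> A B C; apply/val_inj; rewrite /= mulmxA. Qed.
Fact sl_mul1 : left_id sl_one sl_mul.
Proof. by move=> A; apply/val_inj; rewrite /= mul1mx. Qed.
Fact sl_mulr1 : right_id sl_one sl_mul.
Proof. by move=> A; apply/val_inj; rewrite /= mulmx1. Qed.
Fact sl_mulV : left_inverse sl_one sl_inv sl_mul.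
Proof. by move=> A; apply/val_inj; rewrite /= mulVmx ?SL3_unit. Qed.
Fact sl_mulrV : right_inverse sl_one sl_inv sl_mul.
Proof. by move=> A; apply/val_inj; rewrite /= mulmxV ?SL3_unit. Qed.

HB.instance Definition _ :=
  isGroup.Build SL3 sl_mulA sl_mul1 sl_mulr1 sl_mulV sl_mulrV.

(* The antidiagonal matrix with entries 1, -1, 1. With these signs sigma maps
   the root element 1 + t E_12 to 1 + t E_23 and conversely. *)
Definition w0 : 'M[F]_3 :=
  \matrix_(i < 3, j < 3) if (i + j == 2)%N then (-1) ^+ i else 0.

Lemma w0K : w0 *m w0 = 1%:M.
Proof.
apply/matrixP=> i j; rewrite !mxE !big_ord_recl big_ord0 !mxE /=.
case: i => [[|[|[|i]]] ltni] //; case: j => [[|[|[|j]]] ltnj] //;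
  by rewrite /= ?expr0 ?expr1 ?expr2 ?mulr0 ?mul0r ?mulrNN ?mulr1 ?addr0 ?add0r.
Qed.

Lemma w0_tr : w0^T = w0.
Proof.
apply/matrixP=> i j; rewrite !mxE addnC; case: eqP => // ij2.
by case: i j ij2 => [[|[|[|i]]] ltni] [[|[|[|j]]] ltnj] //= _; rewrite sqrrN expr1n.
Qed.

Lemma w0_unit : w0 \in unitmx.
Proof. by case: (mulmx1_unit w0K). Qed.

Lemma invmx_w0 : invmx w0 = w0.
Proof. by rewrite -[LHS]mulmx1 -w0K mulKmx ?w0_unit. Qed.

Fact sigma_subproof A : \det (w0 *m invmx A^T *m invmx w0) == 1.
Proof.
by rewrite !det_mulmx !det_inv det_tr det_SL3 invr1 mulr1 mulrV // -unitmxE w0_unit.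
Qed.
Definition sigma A : SL3 := MkSL3 (sigma_subproof A).

Lemma sigmaM : {morph sigma : A B / (A * B)%g}.
Proof.
move=> A B; apply/val_inj; rewrite /= invmx_w0.
have UA : (A : 'M[F]_3)^T \in unitmx by rewrite unitmx_tr SL3_unit.
have UB : (B : 'M[F]_3)^T \in unitmx by rewrite unitmx_tr SL3_unit.
rewrite -!mulmxA; congr (_ *m _); rewrite [w0 *m (w0 *m _)]mulmxA w0K mul1mx.
rewrite mulmxA; congr (_ *m _).
apply: (can_inj (mulKmx (_ : (A *m B)^T \in unitmx))).
  by rewrite unitmx_tr unitmx_mul !SL3_unit.
by rewrite mulmxV ?unitmx_tr ?unitmx_mul ?SL3_unit // trmx_mul mulmxA mulmxK // mulmxV.
Qed.

Lemma sigmaK : involutive sigma.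
Proof.
move=> A; apply/val_inj; rewrite /= invmx_w0 !trmx_mul w0_tr.
rewrite -trmx_inv trmxK.
have -> : w0 *m (invmx A *m w0) = invmx (w0 *m A *m w0).
  apply: (can_inj (mulKmx (_ : w0 *m A *m w0 \in unitmx))).
    by rewrite !unitmx_mul !w0_unit SL3_unit.
  rewrite mulmxV ?unitmx_mul ?w0_unit ?SL3_unit //.
  rewrite mulmxA -[_ *m w0 *m w0]mulmxA w0K mulmx1 [_ *m (invmx A *m w0)]mulmxA.
  by rewrite mulmxK ?SL3_unit // w0K.
by rewrite invmxK !mulmxA w0K mul1mx -mulmxA w0K mulmx1.
Qed.

(* (A, e) stands for A sigma^e. *)
Definition SL3_sigma := (SL3 * bool)%type.

HB.instance Definition _ := Choice.on SL3_sigma.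

Implicit Types g h : SL3_sigma.

Definition sigma_pow (e : bool) A := if e then sigma A else A.

Definition sd_one : SL3_sigma := (1%g, false).
Definition sd_mul g h : SL3_sigma := ((g.1 * sigma_pow g.2 h.1)%g, g.2 (+) h.2).
Definition sd_inv g : SL3_sigma := (sigma_pow g.2 (g.1^-1)%g, g.2).

Fact sigma_powM e : {morph sigma_pow e : A B / (A * B)%g}.
Proof. by case: e => A B //=; rewrite sigmaM. Qed.

Fact sigma_powD e f A : sigma_pow e (sigma_pow f A) = sigma_pow (e (+) f) A.
Proof. by case: e f => [] [] //=; rewrite sigmaK. Qed.

Fact sigma_pow1 e : sigma_pow e 1%g = 1%g.
Proof.
by apply: (@mulgI _ (sigma_pow e 1%g)); rewrite -sigma_powM mulg1 mulg1.
Qed.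

Fact sd_mulA : associative sd_mul.
Proof.
by move=> g h l; rewrite /sd_mul /= sigma_powM sigma_powD mulgA addbA.
Qed.
Fact sd_mul1 : left_id sd_one sd_mul.
Proof. by case=> A e; rewrite /sd_mul /= mul1g. Qed.
Fact sd_mulr1 : right_id sd_one sd_mul.
Proof. by case=> A e; rewrite /sd_mul /= sigma_pow1 mulg1 addbF. Qed.
Fact sd_mulV : left_inverse sd_one sd_inv sd_mul.
Proof.
by case=> A e; rewrite /sd_mul /sd_inv /= -sigma_powM mulVg sigma_pow1 addbb.
Qed.
Fact sd_mulrV : right_inverse sd_one sd_inv sd_mul.
Proof.
by case=> A e; rewrite /sd_mul /sd_inv /= sigma_powD addbb mulgV.
Qed.

HB.instance Definition _ :=
  isGroup.Build SL3_sigma sd_mulA sd_mul1 sd_mulr1 sd_mulV sd_mulrV.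

(* The coordinates of A sigma^e are the entries of A, then e = 0 or 1, also in
   characteristic 2; the image is the zero set of det - 1 and e^2 - e. *)
Definition G_coord g : 'rV[F]_(3 * 3 + 1) :=
  row_mx (mxvec g.1) (const_mx g.2%:R).

End SL3.

(* Main.v *)
Require Import Defs.
From HB Require Import structures.
From mathcomp Require Import all_boot all_order all_algebra.
From mathcomp Require Import boolp classical_sets.
From mathcomp Require Import mpoly.

(** Every cocharacter of G = SL_3 x| <sigma> takes values in SL_3, because each
    element of the algebraic closure is a square. Conjugating by the diagonal
    cocharacter of weights w multiplies the entries of A and of A sigma by
    explicit powers of a, so for diagonal lambda the group P_lambda can be read
    off the weights: the weights (2, 1, -3) give the upper triangular group B,
    (1, 0, -1) give N = B x| <sigma>, and (1, 1, -2) and (2, -1, -1) give the two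
    maximal parabolic subgroups P_alpha and P_beta of SL_3 above B.

    Take H = B. It lies in N, which is not contained in the identity component.
    If B were contained in a Levi subgroup L_mu of P_mu = N, then mu would
    centralize B, hence be scalar, hence trivial, so that N = G, a contradiction.

    For the second claim, the R-parabolic subgroups containing B would form a
    Boolean lattice in which B is the join of N with P_alpha and with P_beta.
    Since only G contains both P_alpha and P_beta, distributivity makes B the
    join of N with the least element, so N = B, which is absurd. *)

Set Implicit Arguments.
Unset Strict Implicit.
Unset Printing Implicit Defensive.

Import GRing.Theory Num.Theory Order.TTheory.
Local Open Scope classical_set_scope.
Local Open Scope ring_scope.

(** * Fields of definition *)

(** For nonzero [p] the polynomial [p * 'X + 1] is not constant, so it has a root. Its value at 0 is
    1, so the root is nonzero; there [p] vanishes, which gives 1 = 0. *)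
Lemma poly_eq0_off0 (K : closedFieldType) (p : {poly K}) :
  (forall a, a != 0 -> p.[a] = 0) -> p = 0.
Proof.
move=> p0; apply/eqP; apply: contraT => nzp.
have s2 : (1 < size (p * 'X)%R)%N by rewrite size_mulX // ltnS size_poly_gt0.
have /closed_rootP[a] : size (p * 'X + 1) != 1.
  by rewrite size_polyDl ?size_poly1 // neq_ltn s2 orbT.
rewrite /root !hornerE; have [->|/p0 ->] := eqVneq a 0.
  by rewrite mulr0 add0r oner_eq0.
by rewrite mul0r add0r oner_eq0.
Qed.

Lemma mpoly_eq0_eval (K : closedFieldType) (r : nat) (p : {mpoly K[r]}) :
  (forall v, p.@[v] = 0) -> p = 0.
Proof.
move=> p0; apply/mpolyP => e; rewrite mcoeff0.
(* The variables are eliminated one by one, each time by comparing the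
   coefficients of a polynomial in a single variable. *)
have partial j (v : 'I_r -> K) : (j <= r)%N ->
    \sum_(m <- msupp p | [forall i : 'I_r, (i < j)%N ==> (m i == e i)])
      p@_m * \prod_(i < r | (j <= i)%N) v i ^+ m i = 0.
  elim: j v => [|j IHj] v ltjr.
    rewrite -[RHS](p0 v) mevalE; apply: eq_big => [m|m _]; last exact: congr2.
    by apply/forallP.
  pose J := Ordinal ltjr.
  pose C m := p@_m * \prod_(i < r | (j < i)%N) v i ^+ m i.
  pose P (m : 'X_{1..r}) := [forall i : 'I_r, (i < j)%N ==> (m i == e i)].
  pose q : {poly K} := \sum_(m <- msupp p | P m) C m *: 'X^(m J).
  have q0 : q = 0.
    apply: poly_eq0_off0 => t _.
    rewrite -[RHS](IHj (fun i => if i == J then t else v i) (ltnW ltjr)).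
    rewrite /q horner_sum; apply: eq_bigr => m _.
    rewrite !hornerE /C -mulrA; congr (_ * _).
    rewrite [RHS](bigD1 J) //= eqxx mulrC; congr (_ * _).
    apply: eq_big => [i|i]; first by rewrite ltn_neqAle andbC -val_eqE /= eq_sym.
    by case: eqP => // ->; rewrite ltnn.
  transitivity (q`_(e J)); last by rewrite q0 coef0.
  rewrite coef_sum [LHS]big_mkcond [RHS]big_mkcond; apply: eq_bigr => m _.
  rewrite coefZ coefXn -/(C m) /P.
  have -> : [forall i : 'I_r, (i < j.+1)%N ==> (m i == e i)]
          = [forall i : 'I_r, (i < j)%N ==> (m i == e i)] && (e J == m J).
    apply/forallP/andP => [em|[/forallP em /eqP eJ] i].
      split; last by have := em J; rewrite /= ltnSn eq_sym.
      by apply/forallP => i; apply/implyP => /ltnW lti; apply: (implyP (em i)).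
    apply/implyP; rewrite ltnS leq_eqVlt => /orP[/eqP ij|/(implyP (em i))//].
    by have -> : i = J by [exact: val_inj]; rewrite eJ.
  by case: [forall _, _] => //=; case: eqP; rewrite ?mulr1 ?mulr0.
(* With every variable eliminated the products are empty and only the monomial [e] survives. *)
have /(_ (leqnn r)) := partial r (fun=> 0).
have [|/memN_msupp_eq0//] := boolP (e \in msupp p) => ep.
rewrite (big_rem e) //= [X in _ + X]big1_seq ?addr0 => [|m].
  have -> : [forall i : 'I_r, (i < r)%N ==> (e i == e i)].
    by apply/forallP => i; rewrite eqxx implybT.
  by rewrite big_pred0 ?mulr1 // => i; rewrite leqNgt ltn_ord.
rewrite mem_rem_uniq ?msupp_uniq // => /andP[/forallP emi /andP[/negP[]]].
by apply/eqP/mnmP => i; apply/eqP; move: (emi i); rewrite ltn_ord.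
Qed.

Section DefinedOver.
Variables (k : fieldType) (K : closedFieldType) (iota : {rmorphism k -> K}).
Variables (n : nat) (G : groupType) (x : G -> 'rV[K]_n).
Implicit Types (X : set G).

(** Kernels of matrices over [k] are compatible with extension to [K]: the coefficient vector of [f]
    is a [K]-combination of the rows of [kermx A], and these rows give the required polynomials over
    [k]. *)
Lemma defined_over_linear X :
  (forall M (s : 'I_M -> 'X_{1..n}), exists c (A : 'M[k]_(M, c)),
     forall a : 'rV[K]_M,
     vanishes x (\sum_i a 0 i *: 'X_[s i]) X <-> a *m map_mx iota A = 0) ->
  defined_over iota x X.
Proof.
move=> lin f vf.
pose s (i : 'I_(size (msupp f))) := tnth (in_tuple (msupp f)) i.
have [c [A vA]] := lin _ s.
pose v : 'rV[K]_(size (msupp f)) := \row_i f@_(s i).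
have fE : f = \sum_i v 0 i *: 'X_[s i].
  by rewrite {1}[f]mpolyE big_tnth; apply: eq_bigr => i _; rewrite mxE.
have /submxP[u uE] : (v <= map_mx iota (kermx A))%MS.
  by rewrite map_kermx; apply/sub_kermxP/vA; rewrite -fE.
exists _, (u 0), (fun i => \sum_j kermx A i j *: 'X_[s j]).
have mapE i : map_mpoly iota (\sum_j kermx A i j *: 'X_[s j])
            = \sum_j (row i (map_mx iota (kermx A))) 0 j *: 'X_[s j].
  rewrite rmorph_sum; apply: eq_bigr => j _ /=.
  by rewrite map_mpolyZ map_mpolyX !mxE.
split=> [i|]; first by rewrite mapE; apply/vA; rewrite -row_mul -map_mxM mulmx_ker
  map_mx0 row0.
apply: etrans fE _; rewrite uE; under [RHS]eq_bigr do rewrite mapE scaler_sumr.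
rewrite exchange_big; apply: eq_bigr => j _ /=; rewrite mxE scaler_suml.
by apply: eq_bigr => i _; rewrite scalerA !mxE.
Qed.

(* After clearing denominators, vanishing on X is a linear system over k in the
   coefficients, whose solutions over K are spanned by those over k. *)
Lemma defined_over_param (J : finType) (r : nat) (D : J -> {mpoly k[r]})
    (num : J -> 'I_n -> {mpoly k[r]}) X :
  let ev q v := (map_mpoly iota q).@[v] in
  (forall j, D j != 0) ->
  (forall j v, ev (D j) v != 0 ->
     exists2 g, X g & forall l, x g 0 l = ev (num j l) v / ev (D j) v) ->
  (forall g, X g -> exists j v, ev (D j) v != 0 /\
     forall l, x g 0 l = ev (num j l) v / ev (D j) v) ->
  defined_over iota x X.
Proof.
move=> ev nzD X_of of_X; apply: defined_over_linear => M s.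
(* [N] bounds the degrees of the given monomials, so [D j ^+ N] clears all denominators. *)
pose N := (\max_i mdeg (s i))%N.
pose Phi j i := (\prod_l num j l ^+ s i l) * D j ^+ (N - mdeg (s i)).
(* One linear equation for each chart [j] and each monomial occurring in some [Phi j i]. *)
pose C := [seq (j, mu) | j <- enum J,
             mu <- flatten [seq msupp (Phi j i) | i <- enum 'I_M]].
pose A : 'M[k]_(M, size C) :=
  \matrix_(i, c) (Phi (tnth (in_tuple C) c).1 i)@_(tnth (in_tuple C) c).2.
exists _, A => a.
pose h j := \sum_i a 0 i *: map_mpoly iota (Phi j i).
have hE j v g : ev (D j) v != 0 ->
    (forall l, x g 0 l = ev (num j l) v / ev (D j) v) ->
    (h j).@[v] = ev (D j) v ^+ N * (\sum_i a 0 i *: 'X_[s i]).@[x g 0].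
  move=> Dv xg; rewrite !rmorph_sum mulr_sumr; apply: eq_bigr => i _ /=.
  rewrite !mevalZ mulrCA; congr (_ * _); rewrite mevalX.
  under [in RHS]eq_bigr do rewrite xg exprMn exprVn.
  rewrite big_split /= rmorphM rmorph_prod mevalM rmorph_prod mulrCA /=.
  congr (_ * _); first by apply: eq_bigr => l _; rewrite !rmorphXn.
  rewrite !rmorphXn /= -/(ev _ _) prodfV prodrXr -mdegE.
  apply: (mulIf (expf_neq0 (mdeg (s i)) Dv)).
  rewrite mulfVK ?expf_neq0 // -exprD subnK //.
  exact: (leq_bigmax i).
have hA : a *m map_mx iota A = 0 <-> forall j, h j = 0.
  have coefh j mu : (h j)@_mu = \sum_i a 0 i * iota (Phi j i)@_mu.
    rewrite raddf_sum; apply: eq_bigr => i _.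
    by rewrite /= mcoeffZ mcoeff_map_mpoly.
  split=> [aA j|h0].
    apply/mpolyP => mu; rewrite mcoeff0 coefh.
    have [/(tnthP (in_tuple C))[c cE]|muC] := boolP ((j, mu) \in C).
      have := congr1 (fun B : 'rV__ => B 0 c) aA; rewrite !mxE => aA0.
      by rewrite -[RHS]aA0; apply: eq_bigr => i _; rewrite !mxE -cE.
    rewrite big1 // => i _; rewrite memN_msupp_eq0 ?rmorph0 ?mulr0 //.
    apply: contra muC => muP; apply/allpairsPdep.
    exists j, mu; split; rewrite ?mem_enum //.
    by apply/flatten_mapP; exists i; rewrite ?mem_enum.
  apply/rowP => c; rewrite !mxE.
  have := congr1 (mcoeff (tnth (in_tuple C) c).2) (h0 (tnth (in_tuple C) c).1).
  rewrite mcoeff0 coefh => h0c; rewrite -[RHS]h0c; apply: eq_bigr => i _.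
  by rewrite !mxE.
apply: iff_trans (iff_sym hA); split=> [vX j|h0 g /of_X[j [v [Dv xg]]]].
  have nzDj : map_mpoly iota (D j) != 0.
    apply: contra (nzD j) => /eqP Dj0; apply/eqP/mpolyP => mu.
    apply: (fmorph_inj iota).
    by rewrite mcoeff0 rmorph0 -mcoeff_map_mpoly Dj0 mcoeff0.
  (* The chart gives points of [X] only where [D j] does not vanish; the product of [h j] with the
     nonzero polynomial [D j] vanishes everywhere. *)
  apply: (mulIf nzDj); rewrite mul0r; apply: mpoly_eq0_eval => v.
  rewrite mevalM; have [Dv0|Dv] := eqVneq (ev (D j) v) 0.
    by rewrite -/(ev _ _) Dv0 mulr0.
  have [g Xg xg] := X_of j v Dv.
  by rewrite (hE j v g Dv xg) vX // mulr0 mul0r.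
apply: (mulfI (expf_neq0 N Dv)); rewrite -(hE j v g Dv xg) h0.
by rewrite meval0 mulr0.
Qed.
End DefinedOver.

(** * Cocharacters and limits *)

Lemma closed_field_root (K : closedFieldType) (n : nat) (a : K) :
  (0 < n)%N -> exists b, b ^+ n = a.
Proof.
move=> n0; have /closed_rootP[b] : size ('X^n - a%:P) != 1.
  by rewrite size_XnsubC // eqSS -lt0n.
by rewrite /root !hornerE subr_eq0 => /eqP; exists b.
Qed.

Lemma invmxM (R : comUnitRingType) (n : nat) (A B : 'M[R]_n) :
  A \in unitmx -> B \in unitmx -> invmx (A *m B) = invmx B *m invmx A.
Proof.
move=> UA UB; have UAB : A *m B \in unitmx by rewrite unitmx_mul UA.
apply: (can_inj (mulKmx UAB)).
by rewrite mulmxV // mulmxA mulmxK // mulmxV.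
Qed.

Section Cocharacters.
Variable K : closedFieldType.
Implicit Types (g h : SL3_sigma K) (A : SL3 K) (M : 'M[K]_3) (a b : K).
Implicit Types (P Q : 'M[{poly K}]_3) (lambda : K -> SL3_sigma K).
Notation x := (@G_coord K).

Lemma G_coord_mx g i j : x g 0 (lshift 1 (mxvec_index i j)) = g.1 i j.
Proof. by rewrite row_mxEl mxvecE. Qed.

Lemma G_coord_bit g r : x g 0 (rshift (3 * 3) r) = g.2%:R.
Proof. by rewrite row_mxEr mxE. Qed.

Lemma G_coord_ind (S : 'I_(3 * 3 + 1) -> Prop) :
  (forall i j, S (lshift 1 (mxvec_index i j))) ->
  (forall r, S (rshift (3 * 3) r)) -> forall l, S l.
Proof.
move=> Smx Sbit l; case: (split_ordP l) => [m|r] ->; last exact: Sbit.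
by case/mxvec_indexP: m.
Qed.

Definition mxeval a P : 'M[K]_3 := map_mx (horner_eval a) P.

Lemma mxevalE a P i j : mxeval a P i j = (P i j).[a].
Proof. by rewrite mxE. Qed.

Lemma mxevalM a P Q : mxeval a (P *m Q) = mxeval a P *m mxeval a Q.
Proof. exact: map_mxM. Qed.

Lemma mxevalC a M : mxeval a (map_mx polyC M) = M.
Proof. by apply/matrixP => i j; rewrite !mxE /horner_eval hornerC. Qed.

Lemma mxeval_inj P Q :
  (forall a, a != 0 -> mxeval a P = mxeval a Q) -> P = Q.
Proof.
move=> PQ; apply/matrixP => i j; apply/eqP; rewrite -subr_eq0; apply/eqP.
apply: poly_eq0_off0 => a /PQ/matrixP/(_ i j).
by rewrite !mxE !hornerE /horner_eval => ->; rewrite subrr.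
Qed.

Lemma cocharacter_bit lambda a :
  cocharacter x lambda -> a != 0 -> (lambda a).2 = false.
Proof.
move=> [_ lM] nza; have [b ba] := @closed_field_root K 2 a isT.
have nzb : b != 0 by apply: contraNneq nza => b0; rewrite -ba b0 expr0n.
by rewrite -ba expr2 lM //= addbb.
Qed.

Lemma cocharacterM lambda a b : cocharacter x lambda -> a != 0 -> b != 0 ->
  slmx (lambda (a * b)).1 = slmx (lambda a).1 *m slmx (lambda b).1.
Proof.
move=> lc nza nzb; rewrite (lc.2 a b nza nzb) /=.
by rewrite (cocharacter_bit lc nza).
Qed.

Lemma conj_by_bit lambda g a :
  cocharacter x lambda -> a != 0 -> (conj_by lambda g a).2 = g.2.
Proof.
move=> lc nza; rewrite /conj_by /= (cocharacter_bit lc nza) /=.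
by rewrite addbF.
Qed.

Lemma conj_by_mx lambda g a : cocharacter x lambda -> a != 0 ->
  slmx (conj_by lambda g a).1 =
  slmx (lambda a).1 *m slmx g.1 *m slmx (sigma_pow g.2 (lambda a).1^-1%g).
Proof.
move=> lc nza; by rewrite /conj_by /= (cocharacter_bit lc nza) /=.
Qed.

Lemma conj_by_SL3 lambda A a : cocharacter x lambda -> a != 0 ->
  slmx (conj_by lambda (A, false) a).1 =
  slmx (lambda a).1 *m slmx A *m invmx (lambda a).1.
Proof. exact: conj_by_mx. Qed.

Lemma is_limit_mxeval lambda g h : is_limit x (conj_by lambda g) h ->
  exists2 P, forall a, a != 0 -> mxeval a P = (conj_by lambda g a).1
    & mxeval 0 P = h.1.
Proof.
move=> [psi [/choice[p pE] psiE psi0]].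
exists (\matrix_(i, j) p (lshift 1 (mxvec_index i j))) => [a nza|].
  by rewrite -psiE //; apply/matrixP => i j; rewrite !mxE /horner_eval -pE G_coord_mx.
by rewrite -psi0; apply/matrixP => i j; rewrite !mxE /horner_eval -pE G_coord_mx.
Qed.

(** The determinant of [P] is 1 off 0, hence identically, so the value of [P] at 0 lies in [SL3] and
    provides the limit. *)
Lemma P_mxeval lambda g P : cocharacter x lambda ->
  (forall a, a != 0 -> mxeval a P = (conj_by lambda g a).1) -> P_ x lambda g.
Proof.
move=> lc PE.
have detP : \det P = 1.
  apply/eqP; rewrite -subr_eq0; apply/eqP/poly_eq0_off0 => a nza.
  rewrite !hornerE -/(horner_eval a _) -det_map_mx -/(mxeval a P) PE //.
  by rewrite det_SL3 subrr.
have det1 a : \det (mxeval a P) == 1.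
  by rewrite det_map_mx detP rmorph1.
pose psi a : SL3_sigma K := (MkSL3 (det1 a), g.2).
exists (psi 0), psi; split=> // [|a nza].
  apply: G_coord_ind => [i j|r].
    by exists (P i j) => a; rewrite G_coord_mx mxevalE.
  by exists (g.2%:R)%:P => a; rewrite G_coord_bit hornerC.
rewrite [RHS]surjective_pairing conj_by_bit //; congr pair.
exact/val_inj/PE.
Qed.

(* Let b tend to 0 in f (a b) = lambda(a) f(b) lambda(a)^-1. *)
Lemma limit_centralized lambda M P : cocharacter x lambda ->
  (forall a, a != 0 ->
     mxeval a P = slmx (lambda a).1 *m M *m invmx (lambda a).1) ->
  forall a, a != 0 ->
    slmx (lambda a).1 *m mxeval 0 P = mxeval 0 P *m slmx (lambda a).1.
Proof.
move=> lc PE a nza; set L := slmx (lambda a).1.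
have UL : L \in unitmx by exact: SL3_unit.
have scaleE b : mxeval b (map_mx (comp_poly (a *: 'X)) P) = mxeval (a * b) P.
  by apply/matrixP => i j; rewrite !mxE /horner_eval horner_comp !hornerE.
have : map_mx (comp_poly (a *: 'X)) P
     = map_mx polyC L *m P *m map_mx polyC (invmx L).
  apply: mxeval_inj => b nzb.
  rewrite scaleE !mxevalM !mxevalC !PE ?mulf_neq0 // cocharacterM // -/L.
  by rewrite invmxM ?SL3_unit // !mulmxA.
move=> /(congr1 (mxeval 0)); rewrite scaleE mulr0 !mxevalM !mxevalC => P0.
by rewrite [in RHS]P0 mulmxKV.
Qed.

End Cocharacters.

(** * Diagonal cocharacters *)

Lemma ord3_ind (S : 'I_3 -> Prop) :
  S (inord 0) -> S (inord 1) -> S (inord 2) -> forall i, S i.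
Proof.
by move=> S0 S1 S2 i; rewrite -(inord_val i); case: i => [[|[|[|i]]] lti].
Qed.

Lemma sum_ord3 (V : nmodType) (E : 'I_3 -> V) :
  \sum_i E i = E (inord 0) + E (inord 1) + E (inord 2).
Proof.
rewrite !big_ord_recl big_ord0 addr0 addrA.
by congr (E _ + E _ + E _); apply: val_inj; rewrite /= inordK.
Qed.

Section Weights.
Variable K : closedFieldType.
Implicit Types (g h : SL3_sigma K) (A : SL3 K) (M : 'M[K]_3) (a b : K).
Implicit Types (P Q : 'M[{poly K}]_3) (w : 'I_3 -> int) (E : pred bool).
Notation x := (@G_coord K).

Definition weights (a b c : int) : 'I_3 -> int := fun i => nth 0 [:: a; b; c] i.

(* The junk value 1 is taken at a = 0, and wherever the determinant is not 1. *)
Definition weight_cochar w a : SL3_sigma K :=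
  (insubd (1%g : SL3 K) (diag_mx (\row_i a ^ w i)), false).

(* For A sigma the exponent is a sum, since sigma (diag (d_j))^-1 = diag (d_(2-j)). *)
Definition weight_shift w (e : bool) (i j : 'I_3) : int :=
  if e then w i + w (rev_ord j) else w i - w j.

Lemma weight_cochar_mx w a : \sum_i w i = 0 -> a != 0 ->
  slmx (weight_cochar w a).1 = diag_mx (\row_i a ^ w i).
Proof.
move=> w0 nza; apply: insubdK; rewrite unfold_in det_diag.
under eq_bigr do rewrite mxE.
rewrite -[X in _ == X](expr0z a) -w0; apply/eqP/esym.
by apply: (big_morph (fun z => a ^ z)) => [y z|]; rewrite ?expr0z // expfzDr.
Qed.

Lemma weight_cocharacter w : \sum_i w i = 0 -> cocharacter x (weight_cochar w).
Proof.
move=> w0; split=> [|a b nza nzb].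
  apply: G_coord_ind => [i j|r]; last first.
    by exists 0, 0%N => a nza; rewrite G_coord_bit /= hornerC mul0r.
  have [<-|neij] := eqVneq i j; last first.
    exists 0, 0%N => a nza.
    by rewrite G_coord_mx weight_cochar_mx // !mxE (negPf neij) hornerC mul0r.
  have [z0|z0] := ger0P (w i).
    exists 'X^(`|w i|)%N, 0%N => a nza.
    rewrite G_coord_mx weight_cochar_mx // !mxE eqxx !hornerE expr0 divr1 mulr1n.
    by rewrite -{1}(gez0_abs z0).
  exists 1, `|w i|%N => a nza.
  rewrite G_coord_mx weight_cochar_mx // !mxE eqxx !hornerE mulr1n.
  by rewrite exprnN ltz0_abs // opprK.
apply/eqP; rewrite xpair_eqE eqxx andbT; apply/eqP/val_inj.
rewrite /= !weight_cochar_mx ?mulf_neq0 // mulmx_diag; congr diag_mx.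
by apply/rowP => i; rewrite !mxE exprzMl ?unitfE.
Qed.

Lemma w0_diag_w0 (d : 'rV[K]_3) :
  w0 K *m diag_mx d *m w0 K = diag_mx (\row_i d 0 (rev_ord i)).
Proof.
have rev0 : rev_ord (inord 0 : 'I_3) = inord 2 by apply/val_inj; rewrite /= !inordK.
have rev1 : rev_ord (inord 1 : 'I_3) = inord 1 by apply/val_inj; rewrite /= !inordK.
have rev2 : rev_ord (inord 2 : 'I_3) = inord 0 by apply/val_inj; rewrite /= !inordK.
rewrite mul_mx_diag; apply/matrixP => i j; rewrite mxE sum_ord3 !mxE !inordK //.
elim/ord3_ind: i; elim/ord3_ind: j; rewrite ?rev0 ?rev1 ?rev2 -val_eqE /= ?inordK //=;
  rewrite ?(mul0r, mulr0, add0r, addr0, expr0, expr1, mul1r, mulr1) //.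
- by rewrite sqrrN expr1n mulr1.
- by rewrite mulrN1 mulN1r opprK.
- by rewrite sqrrN expr1n mul1r.
Qed.

Lemma conj_by_weight w g a i j : \sum_i w i = 0 -> a != 0 ->
  (conj_by (weight_cochar w) g a).1 i j = a ^ weight_shift w g.2 i j * g.1 i j.
Proof.
move=> w0 nza; rewrite conj_by_mx //; last exact: weight_cocharacter.
(* The right factor does not depend on [i]: subtracting [w i] leaves [- w j] or [w (rev_ord j)],
   which treats both cosets at once. *)
have -> : slmx (sigma_pow g.2 (weight_cochar w a).1^-1%g)
        = diag_mx (\row_j a ^ (weight_shift w g.2 i j - w i)).
  have inv : slmx (weight_cochar w a).1^-1%g = diag_mx (\row_i a ^ (- w i)).
    apply: (can_inj (mulKmx (SL3_unit (weight_cochar w a).1))).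
    rewrite mulmxV ?SL3_unit // weight_cochar_mx // mulmx_diag.
    by apply/matrixP => r c; rewrite !mxE -expfzDr // subrr expr0z.
  rewrite /weight_shift; case: g.2; rewrite /sigma_pow; last first.
    by rewrite inv; congr diag_mx; apply/rowP => c; rewrite !mxE addrC addKr.
  rewrite [LHS]/= invmx_w0 -trmx_inv invmxK weight_cochar_mx // tr_diag_mx.
  rewrite w0_diag_w0; congr diag_mx; apply/rowP => c.
  by rewrite !mxE addrAC subrr add0r.
rewrite weight_cochar_mx // mul_diag_mx mul_mx_diag !mxE.
by rewrite mulrAC -expfzDr // addrC subrK.
Qed.

(** An entry multiplied by a negative power of [a] extends to 0 only if it is 0, while nonnegative
    powers always extend. *)
Lemma P_weightP w g : \sum_i w i = 0 ->
  P_ x (weight_cochar w) g <->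
  (forall i j, weight_shift w g.2 i j < 0 -> g.1 i j = 0).
Proof.
move=> w0; have wc := weight_cocharacter w0.
split=> [[h /is_limit_mxeval[P PE _]] i j z0|g0].
  pose n := `|weight_shift w g.2 i j|%N.
  have zE : weight_shift w g.2 i j = - n%:Z by rewrite ltz0_abs ?opprK.
  have n0 : (0 < n)%N by rewrite absz_gt0 lt_eqF.
  have PX : P i j * 'X^n = (g.1 i j)%:P.
    apply/eqP; rewrite -subr_eq0; apply/eqP/poly_eq0_off0 => a nza.
    rewrite !hornerE -mxevalE PE // conj_by_weight // zE -exprnN.
    by rewrite mulrAC mulVf ?expf_neq0 // mul1r subrr.
  have := congr1 (horner^~ 0) PX; rewrite !hornerE expr0n.
  by rewrite -[n]prednK // mulr0.
(* The absolute value is harmless: where the exponent is negative, the entry is 0 by hypothesis. *)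
pose P : 'M[{poly K}]_3 :=
  \matrix_(i, j) (g.1 i j *: 'X^(`|weight_shift w g.2 i j|)).
apply: (@P_mxeval _ _ _ P) => // a nza; apply/matrixP => i j.
rewrite mxevalE mxE conj_by_weight // !hornerE mulrC.
have [z0|/g0->] := ger0P (weight_shift w g.2 i j); last by rewrite !mulr0.
by rewrite -{2}(gez0_abs z0).
Qed.
End Weights.

(** * Matrices preserving a flag, and their field of definition *)

Section Flags.
Variables (k : fieldType) (K : closedFieldType) (iota : {rmorphism k -> K}).
Implicit Types (g h : SL3_sigma K) (A : SL3 K) (M : 'M[K]_3) (a b : K).
Implicit Types (w : 'I_3 -> int) (E : pred bool).
Notation x := (@G_coord K).

(** Only the order of the weights matters. For weakly decreasing [w] the matrix part stabilizes the
    standard flag with jumps where [w] drops; [E] selects the cosets of [SL3]. *)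
Definition flag w E : set (SL3_sigma K) :=
  [set g : SL3_sigma K | E g.2 /\ forall i j, w i < w j -> g.1 i j = 0].

(* Generic matrices with the zeros prescribed by w are parametrized freely;
   dividing their last row by the determinant yields the elements of SL3. *)
Lemma flag_defined_over w E : defined_over iota x (flag w E).
Proof.
pose X : 'M[{mpoly k[3 * 3]}]_3 :=
  \matrix_(i, j) if w i < w j then 0 else 'X_(mxvec_index i j).
pose D (e : {e : bool | E e}) := \det X.
(* Everything will be divided by [\det X], so the bit and the rows above the last one carry this
   factor in advance. *)
pose num (e : {e : bool | E e}) (l : 'I_(3 * 3 + 1)) :=
  row_mx (mxvec (\matrix_(i, j) if i == ord_max then X i j else X i j * \det X))
         (const_mx ((val e)%:R * \det X)) 0 l.
have num_mx e i j : num e (lshift 1 (mxvec_index i j)) =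
    if i == ord_max then X i j else X i j * \det X.
  by rewrite /num row_mxEl mxvecE mxE.
have num_bit e r : num e (rshift (3 * 3) r) = (val e)%:R * \det X.
  by rewrite /num row_mxEr mxE.
pose ev (v : 'I_(3 * 3) -> K) (q : {mpoly k[3 * 3]}) := (map_mpoly iota q).@[v].
pose Xv v : 'M[K]_3 := map_mx (ev v) X.
have XvE v i j : Xv v i j = if w i < w j then 0 else v (mxvec_index i j).
  rewrite !mxE /ev; case: ifP => _; first by rewrite rmorph0 meval0.
  by rewrite map_mpolyX mevalXU.
have detXv v : ev v (\det X) = \det (Xv v).
  by rewrite /ev -[LHS]/((meval v \o map_mpoly iota) (\det X)) -det_map_mx.
have evM v p q : ev v (p * q) = ev v p * ev v q by rewrite /ev rmorphM mevalM.
apply: (@defined_over_param _ _ _ _ _ _ _ _ D num) => [e|e v Dv|g [Eg gw]].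
(* The identity matrix has the prescribed zeros, so the generic determinant is a nonzero
   polynomial. *)
- apply/eqP => D0; pose v : 'I_(3 * 3) -> K := mxvec (1%:M : 'M[K]_3) 0.
  have : \det (Xv v) = 0 by rewrite -detXv -/(D e) D0 /ev rmorph0 meval0.
  have -> : Xv v = 1%:M.
    apply/matrixP => i j; rewrite XvE /v mxvecE mxE.
    by have [->|] := eqVneq i j; rewrite ?ltxx // mulr0n if_same.
  by rewrite det1 => /eqP; rewrite oner_eq0.
- rewrite -/(ev v _) detXv in Dv.
  pose d : 'rV[K]_3 := \row_i if i == ord_max then (\det (Xv v))^-1 else 1.
  have detdX : \det (diag_mx d *m Xv v) == 1.
    rewrite det_mulmx det_diag (bigD1 ord_max) //= mxE eqxx big1 => [|i ni].
      by rewrite mulr1 mulVf.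
    by rewrite mxE (negPf ni).
  exists (MkSL3 detdX, val e).
    split=> [|i j wij]; first exact: (valP e).
    by rewrite /= mul_diag_mx mxE XvE wij mulr0.
  apply: G_coord_ind => [i j|r].
    rewrite G_coord_mx num_mx -!/(ev v _) detXv /= mul_diag_mx.
    rewrite mxE [d 0 i]mxE [Xv v i j]mxE.
    case: ifP => _; first by rewrite mulrC.
    by rewrite evM detXv mulfK // mul1r.
  rewrite G_coord_bit num_bit -!/(ev v _) evM detXv mulfK //.
  by rewrite /ev rmorph_nat rmorph_nat.
(* The parameters of an element are its own entries, and the denominator is then 1. *)
- exists (exist _ g.2 Eg), (fun l => mxvec g.1 0 l).
  set v := fun l => _.
  have Xg : Xv v = g.1.
    apply/matrixP => i j; rewrite XvE /v mxvecE.
    by case: ifP => // /gw ->.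
  have Dv : ev v (\det X) = 1 by rewrite detXv Xg det_SL3.
  rewrite -!/(ev v _) Dv; split; first exact: oner_neq0.
  apply: G_coord_ind => [i j|r]; rewrite -/(ev v _) divr1.
    rewrite G_coord_mx num_mx -Xg mxE.
    by case: ifP => // _; rewrite evM Dv mulr1.
  rewrite G_coord_bit num_bit evM Dv mulr1 /=.
  by rewrite /ev rmorph_nat rmorph_nat.
Qed.

End Flags.

(** * Distributivity of faces and elementary matrices *)

(** With faces of [A] read as subsets, [A] lies in the unions of [X] and of [Y] with [Z], hence in
    the union of [Z] with the intersection of [X] and [Y], which lies in [Z]. *)
Lemma faces_distributive (T : Type) (le : T -> T -> Prop) (A X Y Z : T) :
  faces_form_power_set le A -> le A A -> le X A -> le Y A -> le Z A ->
  (forall C, le C A -> le X C -> le Z C -> le A C) ->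
  (forall C, le C A -> le Y C -> le Z C -> le A C) ->
  (forall C, le C X -> le C Y -> le C Z) -> le A Z.
Proof.
move=> [S [F [[G _ GK] leF]]] AA XA YA ZA XZ YZ XY.
pose f C (CA : le C A) := F (exist (fun B => le B A) C CA).
have cover C (CA : le C A) : (forall D, le D A -> le C D -> le Z D -> le A D) ->
    f A AA `<=` f C CA `|` f Z ZA.
  move=> CZ; rewrite -[_ `|` _]GK; case GE : (G _) => [D DA].
  apply/(leF (exist _ A AA) (exist _ D DA)); apply: CZ => //.
    apply/(leF (exist _ C CA) (exist _ D DA)); rewrite -GE GK; exact: subsetUl.
  apply/(leF (exist _ Z ZA) (exist _ D DA)); rewrite -GE GK; exact: subsetUr.
have XYZ : f X XA `&` f Y YA `<=` f Z ZA.
  rewrite -[_ `&` _]GK; case GE : (G _) => [D DA].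
  apply/(leF (exist _ D DA) (exist _ Z ZA)); apply: XY.
    apply/(leF (exist _ D DA) (exist _ X XA)); rewrite -GE GK; exact: subIsetl.
  apply/(leF (exist _ D DA) (exist _ Y YA)); rewrite -GE GK; exact: subIsetr.
apply/(leF (exist _ A AA) (exist _ Z ZA)) => s As.
have [Xs|//] := cover X XA XZ s As; have [Ys|//] := cover Y YA YZ s As.
exact: XYZ.
Qed.

(** Isolating one entry in this way is what makes the matrix ring simple. *)
Lemma delta_mul_delta (R : comPzRingType) (n : nat) (M : 'M[R]_n) (p i j q : 'I_n) :
  delta_mx p i *m M *m delta_mx j q = M i j *: delta_mx p q.
Proof.
rewrite -(mul_delta_mx (0 : 'I_1) p i) -(mul_delta_mx (0 : 'I_1) j q).
rewrite -!mulmxA [M *m _]mulmxA -colE [delta_mx 0 i *m _]mulmxA -rowE.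
have -> : row i (col j M) = (M i j)%:M by rewrite [LHS]mx11_scalar !mxE.
by rewrite mul_scalar_mx -scalemxAr mul_delta_mx.
Qed.

Lemma mulmx_deltaE (R : pzRingType) (n : nat) (M : 'M[R]_n) (i j p q : 'I_n) :
  (M *m delta_mx i j) p q = M p i *+ (q == j).
Proof.
rewrite -(mul_delta_mx (0 : 'I_1) i j) mulmxA -colE mxE big_ord1 !mxE eqxx /=.
by rewrite mulr_natr.
Qed.

Lemma delta_mulmxE (R : pzRingType) (n : nat) (M : 'M[R]_n) (i j p q : 'I_n) :
  (delta_mx i j *m M) p q = M j q *+ (p == i).
Proof.
rewrite -(mul_delta_mx (0 : 'I_1) i j) -mulmxA -rowE mxE big_ord1 !mxE eqxx andbT.
by rewrite mulr_natl.
Qed.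

Lemma det_elementary (R : comNzRingType) (n : nat) (i j : 'I_n) :
  i != j -> \det (1%:M + delta_mx i j : 'M[R]_n) = 1.
Proof.
(* Transposition exchanges [i] and [j], so the matrix may be taken lower triangular. *)
wlog ltji : i j / (j < i)%N => [lower|] neij.
  have [ltij|ltji|/val_inj eij] := ltngtP i j; last by rewrite eij eqxx in neij.
    by rewrite -det_tr linearD /= trmx1 trmx_delta lower // eq_sym.
  exact: lower.
rewrite det_trig.
  rewrite big1 // => l _; rewrite !mxE eqxx.
  by have [->|] := eqVneq l i; rewrite ?(negPf neij) /= addr0.
apply/is_trig_mxP => p q ltpq; rewrite !mxE -val_eqE (ltn_eqF ltpq) add0r.
case: eqP => //= pi; case: eqP => //= qj.
by move: ltpq; rewrite pi qj ltnNge ltnW.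
Qed.

(** * The centralizer of the upper triangular group *)

Section Centralizers.
Variable K : closedFieldType.
Implicit Types (g h : SL3_sigma K) (A : SL3 K) (M N : 'M[K]_3) (a b : K).
Implicit Types (P Q : 'M[{poly K}]_3).
Notation x := (@G_coord K).

Definition elementary (i j : 'I_3) : SL3 K :=
  insubd (1%g : SL3 K) (1%:M + delta_mx i j).

Lemma elementary_mx i j : i != j -> slmx (elementary i j) = 1%:M + delta_mx i j.
Proof. by move=> neij; apply: insubdK; rewrite unfold_in det_elementary. Qed.

Lemma exists_neq01 : exists2 t : K, t != 0 & t != 1.
Proof.
apply: contrapT => no; have : 'X - 1 = 0 :> {poly K}.
  apply: poly_eq0_off0 => a nza; rewrite !hornerE; apply/eqP; rewrite subr_eq0.
  by apply: contraT => ne1; case: no; exists a.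
by move/(congr1 (horner^~ 0)); rewrite !hornerE => /eqP; rewrite oppr_eq0 oner_eq0.
Qed.

(** The two simple root elements determine all entries except (0, 2). They also commute with the
    matrix unit at (0, 2), so a torus is needed for that entry. *)
Lemma upper_triangular_centralizer M : let t := weight_cochar (weights 1 (-1) 0) in
  comm_mx M (elementary (inord 0) (inord 1)) ->
  comm_mx M (elementary (inord 1) (inord 2)) ->
  (forall a, a != 0 -> comm_mx M (t a).1) -> is_scalar_mx M.
Proof.
move=> t c01 c12 ct.
have comm i j : i != j -> comm_mx M (elementary i j) -> forall p q,
    M p i *+ (q == j) = M j q *+ (p == i).
  move=> neij; rewrite /comm_mx elementary_mx // mulmxDl mulmxDr mulmx1 mul1mx.
  move=> /addrI /matrixP Mij p q.
  by rewrite -mulmx_deltaE Mij delta_mulmxE.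
have n01 : inord 0 != inord 1 :> 'I_3 by rewrite -val_eqE /= !inordK.
have n12 : inord 1 != inord 2 :> 'I_3 by rewrite -val_eqE /= !inordK.
have n02 : inord 0 != inord 2 :> 'I_3 by rewrite -val_eqE /= !inordK.
have e01 := comm _ _ n01 c01; have e12 := comm _ _ n12 c12.
have n10 : inord 1 != inord 0 :> 'I_3 by rewrite eq_sym.
have n21 : inord 2 != inord 1 :> 'I_3 by rewrite eq_sym.
have n20 : inord 2 != inord 0 :> 'I_3 by rewrite eq_sym.
pose simp := (eqxx, negPf n01, negPf n12, negPf n02, negPf n10, negPf n21, negPf n20).
have M11 := e01 (inord 0) (inord 1); have M10 := e01 (inord 1) (inord 1).
have M20 := e01 (inord 2) (inord 1); have M12 := e01 (inord 0) (inord 2).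
have M22 := e12 (inord 1) (inord 2); have M01 := e12 (inord 0) (inord 2).
have M21 := e12 (inord 2) (inord 2).
rewrite ?simp ?mulr1n ?mulr0n in M11 M10 M20 M12 M22 M01 M21.
(* The weights (1, -1, 0) scale this entry by [a] itself, so any [a] other than 0 and 1 works, in
   every characteristic. *)
have M02 : M (inord 0) (inord 2) = 0.
  have [a nza ne1] := exists_neq01; have := ct a nza.
  rewrite /comm_mx weight_cochar_mx //; last first.
    by rewrite sum_ord3 /weights !inordK.
  rewrite mul_mx_diag mul_diag_mx => /matrixP/(_ (inord 0) (inord 2)).
  rewrite !mxE /weights !inordK //= expr0z mulr1 expr1z => /eqP.
  rewrite -{1}[M _ _]mul1r -subr_eq0 -mulrBl mulf_eq0 subr_eq0 eq_sym (negPf ne1).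
  by move/eqP.
apply/is_scalar_mxP; exists (M (inord 0) (inord 0)).
apply/matrixP => i j; rewrite mxE.
by elim/ord3_ind: i; elim/ord3_ind: j; rewrite ?simp ?mulr1n ?mulr0n -?M22 -?M11.
Qed.

End Centralizers.

(** * Limits of matrices under conjugation *)

Section MatrixLimits.
Variables (K : closedFieldType) (lambda : K -> SL3_sigma K).
Hypothesis lambda_cochar : cocharacter (@G_coord K) lambda.
Implicit Types (g h : SL3_sigma K) (A : SL3 K) (M N : 'M[K]_3) (a b : K).
Implicit Types (P Q : 'M[{poly K}]_3).
Notation x := (@G_coord K).
Notation L := (fun a => slmx (lambda a).1).

(** Limits are taken in the whole matrix ring, so that they can be added and applied to matrix
    units, which are not in [SL3]. *)
Definition has_limit M M0 : Prop :=
  exists2 P, forall a, a != 0 -> mxeval a P = L a *m M *m invmx (L a)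
    & mxeval 0 P = M0.

Lemma has_limit_unique M M0 M1 : has_limit M M0 -> has_limit M M1 -> M0 = M1.
Proof.
move=> [P PE <-] [Q QE <-]; congr mxeval.
by apply: mxeval_inj => a nza; rewrite PE // QE.
Qed.

Lemma has_limitD M N M0 N0 :
  has_limit M M0 -> has_limit N N0 -> has_limit (M + N) (M0 + N0).
Proof.
move=> [P PE <-] [Q QE <-]; exists (P + Q) => [a nza|]; last exact: raddfD.
by rewrite /mxeval raddfD /= -!/(mxeval _ _) PE // QE // mulmxDr mulmxDl.
Qed.

Lemma has_limitM M N M0 N0 :
  has_limit M M0 -> has_limit N N0 -> has_limit (M *m N) (M0 *m N0).
Proof.
move=> [P PE <-] [Q QE <-]; exists (P *m Q) => [a nza|]; last exact: mxevalM.
by rewrite mxevalM PE // QE // !mulmxA mulmxKV ?SL3_unit.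
Qed.

Lemma has_limit_fixed M : (forall a, a != 0 -> comm_mx (L a) M) -> has_limit M M.
Proof.
move=> cM; exists (map_mx polyC M) => [a nza|]; rewrite mxevalC //.
by rewrite cM // mulmxK ?SL3_unit.
Qed.

Lemma has_limit_scalar c : has_limit c%:M c%:M.
Proof. by apply: has_limit_fixed => a _; rewrite /comm_mx scalar_mxC. Qed.

Lemma has_limitB M N M0 N0 :
  has_limit M M0 -> has_limit N N0 -> has_limit (M - N) (M0 - N0).
Proof.
move=> lM lN; rewrite -(scaleN1r N) -(scaleN1r N0) -!mul_scalar_mx.
by apply: has_limitD lM _; apply: has_limitM lN; apply: has_limit_scalar.
Qed.

Lemma has_limit_comm M M0 a : has_limit M M0 -> a != 0 -> comm_mx (L a) M0.
Proof. by move=> [P PE <-] nza; apply: (limit_centralized lambda_cochar PE nza). Qed.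

Lemma is_limit_has_limit A h :
  is_limit x (conj_by lambda (A, false)) h -> has_limit A h.1.
Proof.
move=> /is_limit_mxeval[P PE P0]; exists P => // a nza.
by rewrite PE // conj_by_SL3.
Qed.

Lemma has_limit_sum (I : finType) (F F0 : I -> 'M[K]_3) :
  (forall i, has_limit (F i) (F0 i)) -> has_limit (\sum_i F i) (\sum_i F0 i).
Proof.
move=> FF0; apply: (big_ind2 has_limit) => // [|*]; last exact: has_limitD.
by rewrite -(raddf0 (@scalar_mx K 3)); apply: has_limit_scalar.
Qed.

(* M |-> lim (lambda(a) M lambda(a)^-1) is an idempotent ring endomorphism of
   the simple ring of 3 x 3 matrices, so it is the identity. *)
Lemma has_limit_all_fixed :
  (forall i j, exists M0, has_limit (delta_mx i j) M0) ->
  forall M a, a != 0 -> comm_mx (L a) M.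
Proof.
move=> lim_delta M a nza.
have [M0 MM0] : exists M0, has_limit M M0.
  have /choice[F FE] (ij : 'I_3 * 'I_3) : exists M1, has_limit (delta_mx ij.1 ij.2) M1.
    exact: lim_delta.
  rewrite [M]matrix_sum_delta; under eq_bigr do under eq_bigr do rewrite -mul_scalar_mx.
  eexists; apply: has_limit_sum => i; apply: has_limit_sum => j.
  by apply: has_limitM (has_limit_scalar _) (FE (i, j)).
suff -> : M = M0 by exact: (has_limit_comm MM0 nza).
(* Idempotence: [M0] commutes with the cocharacter, so it is its own limit. *)
have N0 : has_limit (M - M0) 0.
  rewrite -(subrr M0); apply: has_limitB => //; apply: has_limit_fixed => b nzb.
  exact: (has_limit_comm MM0 nzb).
apply/eqP; rewrite -subr_eq0; apply/eqP/matrixP => i j; rewrite [RHS]mxE.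
(* Sandwiching between matrix units turns an entry of [M - M0] into a scalar matrix, whose limit is
   both 0 and itself. *)
have : has_limit ((M - M0) i j)%:M 0.
  rewrite scalar_mx_sum_delta; under eq_bigr do rewrite -delta_mul_delta.
  have := @has_limit_sum 'I_3 _ (fun=> 0) _; rewrite big1_eq; apply=> p.
  have [X lX] := lim_delta p i; have [Y lY] := lim_delta j p.
  by have := has_limitM (has_limitM lX N0) lY; rewrite mulmx0 mul0mx.
move=> /has_limit_unique/(_ (has_limit_scalar _))/matrixP/(_ i i).
by rewrite !mxE eqxx mulr1n => <-.
Qed.

(** A scalar matrix of determinant 1 has cube 1, and every [a] is a cube, so the cocharacter is
    trivial. *)
Lemma scalar_cocharacter_trivial :
  (forall a, a != 0 -> is_scalar_mx (L a)) -> P_ x lambda = setT.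
Proof.
move=> scL; have lam1 a : a != 0 -> lambda a = 1%g.
  move=> nza; have [b ba] := @closed_field_root K 3 a isT.
  have nzb : b != 0 by apply: contraNneq nza => b0; rewrite -ba b0 expr0n.
  have /is_scalar_mxP[c Lb] := scL b nzb.
  have c3 : c ^+ 3 = 1 by rewrite -(det_SL3 (lambda b).1) Lb det_scalar.
  rewrite [LHS]surjective_pairing (cocharacter_bit lambda_cochar nza).
  congr pair; apply: val_inj.
  rewrite /= -ba exprS expr2 !cocharacterM ?mulf_neq0 // Lb -!scalar_mxM.
  by rewrite -expr2 -exprS c3.
rewrite -subTset => g _; apply: (@P_mxeval _ _ _ (map_mx polyC g.1)) => // a nza.
by rewrite mxevalC /conj_by lam1 // invg1 mulg1 mul1g.
Qed.

(** This applies to any R-parabolic subgroup above P_alpha and P_beta. The missing matrix unit at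
    (2, 0) is the product of those at (2, 1) and (1, 0), so all matrices have limits and the
    cocharacter is scalar. *)
Lemma elementary_P_trivial :
  (forall i j, i != j -> (i, j) != (inord 2, inord 0) ->
     P_ x lambda (elementary K i j, false)) ->
  P_ x lambda = setT.
Proof.
move=> Pel.
have n01 : inord 0 != inord 1 :> 'I_3 by rewrite -val_eqE /= !inordK.
have lim_mul i j l : (exists M0, has_limit (delta_mx i j) M0) ->
    (exists M0, has_limit (delta_mx j l) M0) ->
    exists M0, has_limit (delta_mx i l) M0.
  move=> [M0 lM] [N0 lN]; exists (M0 *m N0).
  by rewrite -(mul_delta_mx j); apply: has_limitM.
have lim_el i j : i != j -> (i, j) != (inord 2, inord 0) ->
    exists M0, has_limit (delta_mx i j) M0.
  move=> neij ne20; have [h /is_limit_has_limit] := Pel i j neij ne20.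
  rewrite elementary_mx // => lim1; exists (slmx h.1 - 1%:M).
  rewrite -[delta_mx i j](addrK 1%:M) [_ + 1%:M]addrC.
  by apply: has_limitB => //; apply: has_limit_scalar.
have lim_ne i j : i != j -> exists M0, has_limit (delta_mx i j) M0.
  move=> neij; have [[-> ->]|ne20] := eqVneq (i, j) (inord 2, inord 0);
    last exact: lim_el.
  apply: (lim_mul _ (inord 1)); apply: lim_el;
    by rewrite ?xpair_eqE -!val_eqE /= !inordK.
apply: scalar_cocharacter_trivial => a nza.
have cM M : comm_mx (L a) M.
  apply: has_limit_all_fixed nza => i j; have [<-|/lim_ne//] := eqVneq i j.
  (* A diagonal matrix unit is a product of two off-diagonal ones, through any index other than
     [i]. *)
  have [i0|ni0] := eqVneq i (inord 0).
    by apply: (lim_mul _ (inord 1)); apply: lim_ne; rewrite i0 // eq_sym.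
  by apply: (lim_mul _ (inord 0)); apply: lim_ne; rewrite // eq_sym.
exact: upper_triangular_centralizer.
Qed.

End MatrixLimits.

(** * The R-parabolic subgroups above B *)

Section Parabolics.
Variables (k : fieldType) (K : closedFieldType) (iota : {rmorphism k -> K}).
Implicit Types (g h : SL3_sigma K) (A : SL3 K) (M : 'M[K]_3) (a b : K).
Implicit Types (w : 'I_3 -> int) (E : pred bool).
Notation x := (@G_coord K).

(* flag wB (pred1 false) = B, flag wN predT = N_G(B), and flag wa (pred1 false)
   and flag wb (pred1 false) are the parabolic subgroups P_alpha and P_beta. *)
Definition wB := weights 2 1 (-3).
Definition wN := weights 1 0 (-1).
Definition wa := weights 1 1 (-2).
Definition wb := weights 2 (-1) (-1).

(** For such weights [w i + w (rev_ord j)] equals [w i - w j], so both cosets of [SL3] obey the same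
    conditions. *)
Lemma P_symmetric_weight w : \sum_i w i = 0 -> (forall i, w (rev_ord i) = - w i) ->
  P_ x (@weight_cochar K w) = @flag K w predT.
Proof.
move=> w0 w_sym; apply/seteqP; split=> [g /(P_weightP _ w0) gw|g [_ gw]].
  split=> // i j wij; apply: gw; rewrite /weight_shift w_sym if_same.
  by rewrite subr_lt0.
apply/P_weightP => // i j; rewrite /weight_shift w_sym if_same subr_lt0.
exact: gw.
Qed.

(** The second hypothesis excludes the coset of sigma: no matrix in [SL3] has the zeros required
    there. *)
Lemma P_asymmetric_weight w : \sum_i w i = 0 ->
  (forall A, ~ forall i j, w i + w (rev_ord j) < 0 -> A i j = 0) ->
  P_ x (@weight_cochar K w) = @flag K w (pred1 false).
Proof.
move=> w0 w_asym; apply/seteqP.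
split=> [[A [] /(P_weightP _ w0) gw]|[A e] [/eqP/= -> gw]].
- by case: (w_asym A).
- by split=> // i j wij; apply: gw; rewrite /weight_shift subr_lt0.
- by apply/P_weightP => // i j; rewrite /weight_shift subr_lt0; apply: gw.
Qed.

Lemma Lambda_flag w E : \sum_i w i = 0 ->
  P_ x (@weight_cochar K w) = @flag K w E -> Lambda iota x (@flag K w E).
Proof.
move=> w0 Pw; split; last exact: flag_defined_over.
by exists (@weight_cochar K w) => //; apply: weight_cocharacter.
Qed.

Lemma flag_elementary w E i j : E false -> i != j -> w j <= w i ->
  @flag K w E (elementary K i j, false).
Proof.
move=> E0 neij wji; split=> // p q wpq; rewrite elementary_mx // !mxE.
have /negPf-> : p != q by apply: contraTneq wpq => ->; rewrite ltxx.
rewrite add0r; case: eqP => //= pi; case: eqP => //= qj.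
by move: wpq; rewrite pi qj ltNge wji.
Qed.

Lemma SL3_row_neq0 A i : ~ forall j, A i j = 0.
Proof.
move=> Ai; have /matrixP/(_ i i) := mulmxV (SL3_unit A).
rewrite !mxE eqxx big1 => [/eqP|j _]; last by rewrite Ai mul0r.
by rewrite eq_sym oner_eq0.
Qed.

Ltac weight_simpl := rewrite /wB /wN /wa /wb /weights /= ?inordK //=.

(** The sum of -3 with any of the weights is negative, so an element of the coset of sigma would
    have zero last row. *)
Lemma P_wB : P_ x (@weight_cochar K wB) = @flag K wB (pred1 false).
Proof.
apply: P_asymmetric_weight => [|A A0]; first by rewrite sum_ord3; weight_simpl.
apply: (@SL3_row_neq0 A (inord 2)) => j; apply: A0.
by elim/ord3_ind: j; weight_simpl.
Qed.

Lemma P_wN : P_ x (@weight_cochar K wN) = @flag K wN predT.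
Proof.
apply: P_symmetric_weight => [|i]; first by rewrite sum_ord3; weight_simpl.
by elim/ord3_ind: i; weight_simpl.
Qed.

Lemma P_wa : P_ x (@weight_cochar K wa) = @flag K wa (pred1 false).
Proof.
apply: P_asymmetric_weight => [|A A0]; first by rewrite sum_ord3; weight_simpl.
apply: (@SL3_row_neq0 A (inord 2)) => j; apply: A0.
by elim/ord3_ind: j; weight_simpl.
Qed.

(** No row need vanish here; instead columns 0 and 1 would both be supported in row 0, hence be
    dependent. *)
Lemma P_wb : P_ x (@weight_cochar K wb) = @flag K wb (pred1 false).
Proof.
apply: P_asymmetric_weight => [|A A0]; first by rewrite sum_ord3; weight_simpl.
have [A10 A20 A11 A21] : [/\ A (inord 1) (inord 0) = 0, A (inord 2) (inord 0) = 0,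
    A (inord 1) (inord 1) = 0 & A (inord 2) (inord 1) = 0].
  by split; apply: A0; weight_simpl.
have /matrixP CA := mulVmx (SL3_unit A).
have := CA (inord 0) (inord 0); have := CA (inord 0) (inord 1).
have := CA (inord 1) (inord 1).
rewrite !mxE !sum_ord3 A10 A20 A11 A21 !mulr0 !addr0 -!val_eqE /= !inordK //=.
move=> C1 /eqP; rewrite mulf_eq0 => /orP[] /eqP C0.
  by rewrite C0 mul0r => /eqP; rewrite eq_sym oner_eq0.
by move: C1; rewrite C0 mulr0 => /eqP; rewrite eq_sym oner_eq0.
Qed.

Lemma flag_wBP g : @flag K wB (pred1 false) g <->
  [/\ g.2 = false, g.1 (inord 1) (inord 0) = 0, g.1 (inord 2) (inord 0) = 0
    & g.1 (inord 2) (inord 1) = 0].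
Proof.
split=> [[/eqP/= g2 g0]|[g2 g10 g20 g21]]; first by split=> //; apply: g0; weight_simpl.
split=> [|i j]; first exact/eqP.
by elim/ord3_ind: i; elim/ord3_ind: j; weight_simpl.
Qed.

Lemma flag_wB_subgroup : subgroup (@flag K wB (pred1 false)).
Proof.
split=> [|[A e] [B f] /flag_wBP[/= -> A10 A20 A21] /flag_wBP[/= -> B10 B20 B21]
         |[A e] /flag_wBP[/= -> A10 A20 A21]]; apply/flag_wBP.
- by rewrite /= !mxE -!val_eqE /= !inordK.
- by rewrite /= !mxE !sum_ord3 A10 A20 A21 B10 B20 B21 !(mul0r, mulr0, addr0).
(* The inverse is solved column by column: the pivot at (0, 0) clears its first column, then the
   pivot at (1, 1) its second. *)
have /matrixP CA := mulVmx (SL3_unit A).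
have nz (y z : K) : y * z = 1 -> z != 0.
  by move=> yz; apply: contra_eq_neq yz => ->; rewrite mulr0 eq_sym oner_eq0.
have C00 := CA (inord 0) (inord 0); have C10 := CA (inord 1) (inord 0).
have C20 := CA (inord 2) (inord 0); have C11 := CA (inord 1) (inord 1).
have C21 := CA (inord 2) (inord 1).
rewrite !mxE !sum_ord3 ?A10 ?A20 ?A21 ?(mulr0, addr0) -!val_eqE /= !inordK //=
  in C00 C10 C20 C11 C21.
have A00 := nz _ _ C00.
move/eqP: C10; rewrite mulf_eq0 (negPf A00) orbF => /eqP C10.
move/eqP: C20; rewrite mulf_eq0 (negPf A00) orbF => /eqP C20.
rewrite C10 mul0r add0r in C11; rewrite C20 mul0r add0r in C21.
by move/eqP: C21; rewrite mulf_eq0 (negPf (nz _ _ C11)) orbF => /eqP C21.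
Qed.

Lemma flag_zclosed w : zclosed x (@flag K w (pred1 false)).
Proof.
exists [set f | f = 'X_(rshift (3 * 3) ord0)
        \/ exists i j, w i < w j /\ f = 'X_(lshift 1 (mxvec_index i j))].
apply/seteqP; split=> [g [/eqP/= g2 g0] f [->|[i [j [wij ->]]]]|g fg].
- by rewrite mevalXU G_coord_bit g2.
- by rewrite mevalXU G_coord_mx g0.
split=> [|i j wij].
  have := fg _ (or_introl erefl); rewrite mevalXU G_coord_bit /=.
  by case: g.2 => // /eqP; rewrite oner_eq0.
have := fg 'X_(lshift 1 (mxvec_index i j)); rewrite mevalXU G_coord_mx.
by apply; right; exists i, j.
Qed.

(** The two cosets of [SL3] are closed, disjoint and cover G, so a connected set containing 1 stays
    in [SL3]. *)
Lemma identity_component_bit g : identity_component x g -> g.2 = false.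
Proof.
move=> [X [X_conn X1 Xg]]; case g2: g.2 => //.
pose Z e : set (SL3_sigma K) := [set h | h.2 = e].
have Zc e : zclosed x (Z e).
  exists [set 'X_(rshift (3 * 3) ord0) - (e%:R)%:MP]; apply/seteqP.
  split=> [h /= he _ ->|h /(_ _ erefl)]; rewrite mevalB mevalXU mevalC G_coord_bit.
    by rewrite he subrr.
  rewrite /Z /=; case: h.2; case: e => //= /eqP.
    by rewrite subr0 oner_eq0.
  by rewrite sub0r oppr_eq0 oner_eq0.
have [||XZ|XZ] := X_conn _ _ (Zc true) (Zc false).
- by move=> h _; rewrite /Z /=; case: h.2; [left|right].
- by rewrite -subset0 => h [_ [+ hf]]; rewrite /Z /= hf.
- by have := XZ _ X1.
- by have := XZ _ Xg; rewrite /Z /= g2.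
Qed.

Lemma flag_wN_neqT : @flag K wN predT <> setT.
Proof.
move=> NT; have [_ /(_ (inord 2) (inord 0))] :
  @flag K wN predT (elementary K (inord 2) (inord 0), false) by rewrite NT.
rewrite elementary_mx -?val_eqE /= ?inordK // !mxE !eqxx -val_eqE /= !inordK //= add0r.
by weight_simpl => /(_ isT)/eqP; rewrite oner_eq0.
Qed.

Lemma Levi_wN_not_contains_B L : R_Levi x (@flag K wN predT) L ->
  ~ @flag K wB (pred1 false) `<=` L.
Proof.
move=> [mu [mu_cochar PE ->]] BL.
have comm g a : @flag K wB (pred1 false) g -> a != 0 -> comm_mx (slmx (mu a).1) g.1.
  case: g => A e Bg; have := BL _ Bg; case/flag_wBP: Bg => /= -> _ _ _.
  move=> /(is_limit_has_limit mu_cochar) lim nza.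
  exact: (has_limit_comm mu_cochar lim nza).
have scalar a : a != 0 -> is_scalar_mx (slmx (mu a).1).
  move=> nza; apply: upper_triangular_centralizer => [||b nzb].
  - apply: (comm (elementary K (inord 0) (inord 1), false)) => //.
    by apply: flag_elementary; rewrite // -?val_eqE; weight_simpl.
  - apply: (comm (elementary K (inord 1) (inord 2), false)) => //.
    by apply: flag_elementary; rewrite // -?val_eqE; weight_simpl.
  - apply: (comm (@weight_cochar K (weights 1 (-1) 0) b)) => //.
    split=> // i j wij; rewrite weight_cochar_mx // ?sum_ord3; last by weight_simpl.
    by rewrite !mxE; case: eqP wij => // ->; rewrite ltxx.
by apply: flag_wN_neqT; rewrite PE; apply: scalar_cocharacter_trivial.
Qed.

Lemma flag_wB_sub_wN : @flag K wB (pred1 false) `<=` @flag K wN predT.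
Proof.
move=> g /flag_wBP[_ g10 g20 g21]; split=> // i j.
by elim/ord3_ind: i; elim/ord3_ind: j; weight_simpl.
Qed.

Lemma flag_wN_sigma : @flag K wN predT (1%g, true).
Proof. by split=> // i j wij; rewrite mxE; case: eqP wij => // ->; rewrite ltxx. Qed.

Lemma Lambda_wB : Lambda iota x (flag wB (pred1 false)).
Proof. by apply: Lambda_flag P_wB; rewrite sum_ord3; weight_simpl. Qed.

Lemma Lambda_wN : Lambda iota x (flag wN predT).
Proof. by apply: Lambda_flag P_wN; rewrite sum_ord3; weight_simpl. Qed.

Lemma Lambda_wa : Lambda iota x (flag wa (pred1 false)).
Proof. by apply: Lambda_flag P_wa; rewrite sum_ord3; weight_simpl. Qed.

Lemma Lambda_wb : Lambda iota x (flag wb (pred1 false)).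
Proof. by apply: Lambda_flag P_wb; rewrite sum_ord3; weight_simpl. Qed.

Lemma flag_wB_sub_wa : @flag K wB (pred1 false) `<=` flag wa (pred1 false).
Proof.
move=> g /flag_wBP[g2 g10 g20 g21]; split=> [|i j]; first exact/eqP.
by elim/ord3_ind: i; elim/ord3_ind: j; weight_simpl.
Qed.

Lemma flag_wB_sub_wb : @flag K wB (pred1 false) `<=` flag wb (pred1 false).
Proof.
move=> g /flag_wBP[g2 g10 g20 g21]; split=> [|i j]; first exact/eqP.
by elim/ord3_ind: i; elim/ord3_ind: j; weight_simpl.
Qed.

Lemma flag_wa_wN g : flag wa (pred1 false) g -> flag wN predT g ->
  flag wB (pred1 false) g.
Proof.
move=> [/eqP g2 _] [_ g0]; apply/flag_wBP.
by split=> //; apply: g0; weight_simpl.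
Qed.

Lemma flag_wb_wN g : flag wb (pred1 false) g -> flag wN predT g ->
  flag wB (pred1 false) g.
Proof.
move=> [/eqP g2 _] [_ g0]; apply/flag_wBP.
by split=> //; apply: g0; weight_simpl.
Qed.

Lemma flag_wa_wb_elementary (C : set (SL3_sigma K)) i j :
  flag wa (pred1 false) `<=` C -> flag wb (pred1 false) `<=` C ->
  i != j -> (i, j) != (inord 2, inord 0) -> C (elementary K i j, false).
Proof.
move=> aC bC neij ne20.
have [wji|wij] := leP (wa j) (wa i); first by apply/aC/flag_elementary.
(* Only (2, 1) remains, and [wb] takes equal values at 1 and 2. *)
apply/bC/flag_elementary => //; move: wij ne20.
by elim/ord3_ind: i neij; elim/ord3_ind: j; weight_simpl; rewrite ?eqxx.
Qed.

End Parabolics.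

Theorem theorem1p8 (k : fieldType) (K : closedFieldType)
    (iota : {rmorphism k -> K})
    (K_algebraic : forall a : K, algebraicOver iota a) :
  (exists H : set (SL3_sigma K),
      [/\ k_subgroup iota (@G_coord K) H,
          ~ G_cr_over iota (@G_coord K) H
        & ~ (Lambda_fix iota (@G_coord K) H `\` [set setT]
               `<=` building iota (@G_coord K))])
  /\ ~ simplicial_complex (@rev_incl (SL3_sigma K) (Lambda iota (@G_coord K))).
Proof.
have LB := Lambda_wB iota; have LN := Lambda_wN iota.
have La := Lambda_wa iota; have Lb := Lambda_wb iota.
have BN := @flag_wB_sub_wN K.
split.
  exists (flag wB (pred1 false)); split.
  - split; [exact: flag_wB_subgroup|exact: flag_zclosed|exact: flag_defined_over].
  - move=> /(_ _ LN BN)[L [Levi_L _ BL]].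
    exact: Levi_wN_not_contains_B Levi_L BL.
  move=> /(_ (flag wN predT)) sub_building.
  have [|[_ _ PG _] _ _] := sub_building.
    split=> [|NT]; [by split | exact: (@flag_wN_neqT K)].
  by have := identity_component_bit (PG _ (@flag_wN_sigma K)).
move=> [_ faces _].
pose B := exist (Lambda iota (@G_coord K)) _ LB.
pose N := exist (Lambda iota (@G_coord K)) _ LN.
pose Pa := exist (Lambda iota (@G_coord K)) _ La.
pose Pb := exist (Lambda iota (@G_coord K)) _ Lb.
(* In the reversed order the goal says that [N] is contained in [B], which sigma contradicts. *)
suff /(_ _ (@flag_wN_sigma K)) /flag_wBP[] :
  @rev_incl _ (Lambda iota (@G_coord K)) B N by [].
apply: (faces_distributive (X := Pa) (Y := Pb) (faces B)) => //.
- exact: flag_wB_sub_wa.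
- exact: flag_wB_sub_wb.
- by move=> [C LC] _ /= Ca CN g Cg; apply: flag_wa_wN; [exact: Ca|exact: CN].
- by move=> [C LC] _ /= Cb CN g Cg; apply: flag_wb_wN; [exact: Cb|exact: CN].
(* A common face of [Pa] and [Pb] is an R-parabolic subgroup containing both, hence all of G, so it
   contains [N]. *)
move=> [C [[mu mu_cochar CE] C_k]] /= aC bC.
rewrite /rev_incl /= CE elementary_P_trivial // => i j neij ne20.
by rewrite -CE; apply: flag_wa_wb_elementary.
Qed.
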